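(* For $n\ge 3$, let $S_2(n)$ be the minimum size of a 2-CNF encoding of $\mathrm{AMO}_n$. Then: (1) if $n\le 10$, then $S_2(n)=3n-6$; (2) if $n\ge 9$, then $S_2(n)\ge 2n+2\sqrt{n}-3$.
   Context: A CNF formula is a conjunction of clauses (disjunctions of literals with no complementary pair); its size is the number of clauses; a 2-CNF formula has every clause of at most two literals. $\mathrm{AMO}_n(x_1,\dots,x_n)$ is the boolean function equal to $1$ iff at most one $x_i$ equals $1$. A CNF formula $\varphi(\mathbf{x},\mathbf{y})$ with input variables $\mathbf{x}=(x_1,\dots,x_n)$ and auxiliary variables $\mathbf{y}=(y_1,\dots,y_\ell)$ is an encoding of $f(\mathbf{x})$ if for all $\alpha\in\{0,1\}^n$: $f(\alpha)=1$ iff there exists $\beta\in\{0,1\}^\ell$ with $\varphi(\alpha,\beta)=1$ (propagation completeness is not required). *)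

(* Defs.v *)
From mathcomp Require Import all_boot all_order all_algebra.
From mathcomp Require Import boolp reals.

Set Implicit Arguments.
Unset Strict Implicit.
Unset Printing Implicit Defensive.

(* [(v, true)] is the literal v and [(v, false)] its negation; a clause is a
   set of literals and a formula is a set of clauses, so that the size of a
   formula [phi] is [#|phi|]. *)
Notation literal V := (V * bool)%type.
Notation cnf V := {set {set literal V}}.

Definition is_clause (V : finType) (C : {set literal V}) : bool :=
  [forall v : V, ~~ (((v, true) \in C) && ((v, false) \in C))].

Definition is_cnf (V : finType) (phi : cnf V) : bool :=
  [forall C in phi, is_clause C].

Definition is_2cnf (V : finType) (phi : cnf V) : bool :=
  is_cnf phi && [forall C in phi, #|C| <= 2].

Definition eval_lit (V : finType) (a : V -> bool) (x : literal V) : bool :=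
  a x.1 == x.2.

Definition eval_cnf (V : finType) (a : V -> bool) (phi : cnf V) : bool :=
  [forall C in phi, [exists x in C, eval_lit a x]].

(* Input variables are [inl i], auxiliary variables are [inr j]. *)
Definition assign (n l : nat) (a : {ffun 'I_n -> bool}) (b : {ffun 'I_l -> bool})
    (v : 'I_n + 'I_l) : bool :=
  match v with inl i => a i | inr j => b j end.

Definition encodes (n l : nat) (phi : cnf ('I_n + 'I_l)%type)
    (f : {ffun 'I_n -> bool} -> bool) : Prop :=
  forall a : {ffun 'I_n -> bool},
    f a <-> exists b : {ffun 'I_l -> bool}, eval_cnf (assign a b) phi.

Definition AMO (n : nat) (a : {ffun 'I_n -> bool}) : bool :=
  #|[set i | a i]| <= 1.

Definition AMO_2cnf_size (n s : nat) : Prop :=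
  exists (l : nat) (phi : cnf ('I_n + 'I_l)%type),
    [/\ is_2cnf phi, encodes phi (@AMO n) & #|phi| = s].

Lemma AMO_2cnf_size_ex (n : nat) : exists s, `[< AMO_2cnf_size n s >].
Proof.
pose V := ('I_n + 'I_0)%type.
pose cl (p : 'I_n * 'I_n) : {set literal V} :=
  [set (inl p.1, false); (inl p.2, false)].
pose phi : cnf V := [set cl p | p in [set p : 'I_n * 'I_n | p.1 != p.2]].
exists #|phi|; apply/asboolP; exists 0, phi; split=> //.
- apply/andP; split; apply/forall_inP => C /imsetP[p _ ->].
    by apply/forallP => v; rewrite !inE !xpair_eqE !andbF.
  by rewrite cards2; case: (_ != _).
- move=> a; split.
    move=> /card_le1_eqP ha; exists [ffun=> true]; apply/forall_inP => C.
    case/imsetP=> -[i j]; rewrite inE /= => nij ->.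
    case ai: (a i).
      apply/existsP; exists (inl j, false).
      rewrite !inE eqxx orbT /eval_lit /=; apply/eqP/negbTE/negP => aj.
      by move: nij; rewrite (ha i j) ?inE ?eqxx.
    by apply/existsP; exists (inl i, false); rewrite !inE eqxx /eval_lit /= ai.
case=> b /forall_inP hb; apply/card_le1_eqP => i j; rewrite !inE => ai aj.
apply/eqP; apply/negPn/negP => nij.
have /existsP[x] : [exists x in cl (i, j), eval_lit (assign a b) x].
  by apply: hb; apply: imset_f; rewrite inE /= eq_sym.
by rewrite !inE => /andP[/orP[]/eqP-> /eqP /=]; rewrite ?ai ?aj.
Qed.

Definition S2 (n : nat) : nat := ex_minn (AMO_2cnf_size_ex n).

(* Main.v *)
(* Generalise the n inputs of an encoding to n literals of a 2-CNF formula that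
   are individually consistent and pairwise contradictory, let S(n) be the least
   number of clauses, and induct on the number of clauses. Common models are
   always obtained from the closure of 2-CNF under majority: three sets of
   literals have a common model as soon as any two of them do.

   If at most one clause contains the negation of an input z, that is, if z has
   at most one successor in the implication graph, replace z by this successor
   and save the clause. If z has at least three successors, set z false. If two
   inputs share a clause, set one of them false and replace the other. Each time
   either n is unchanged and a clause is saved, or n drops by 1 and three clauses
   are saved.

   Otherwise every input has exactly two successors and the 2n clauses involved
   are distinct. Among the successors take u entailed by as few inputs as
   possible, say by the a inputs of Z. Setting u and Z false saves 2a clauses
   plus those containing the negation of u, of which there are at least two (else
   u could be eliminated). On the other hand each z in Z has one successor that
   entails u, which by minimality is entailed by all of Z, so the conflicts
   inside Z come from the other successors; these form an exclusive family of
   size a within the clauses free of inputs. Hence the size is at least both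
   S(n - a) + 2a + 2 and 2n + S(a); one of them can be improved slightly
   depending on whether the negation of u is also a successor.

   For the upper bound, three clauses introduce a variable implied by two inputs
   and forbid both, which reduces n by 1; at n = 3 the pairwise encoding is optimal. *)
Require Import Defs.
From mathcomp Require Import all_boot all_order all_algebra.
From mathcomp Require Import boolp reals.
From mathcomp Require Import zify.

Set Implicit Arguments.
Unset Strict Implicit.
Unset Printing Implicit Defensive.
Import GRing.Theory Num.Theory.

(** * The size bound and its recursion *)

(* For [10 < n] this is [2 n + 2 sqrt n - 3 <= s] squared; the truncated
   subtraction is harmless because the inequality fails when it gives [0]. *)
Definition size_bound (n s : nat) : bool :=
  if n <= 10 then 3 * n - 6 <= s else 4 * n <= (s + 3 - 2 * n) ^ 2.

Lemma size_bound_mono n s t : s <= t -> size_bound n s -> size_bound n t.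
Proof.
rewrite /size_bound; case: ifP => _ st; first by move/leq_trans; apply.
by move/leq_trans; apply; rewrite leq_exp2r //; lia.
Qed.

Lemma size_bound_small n s : n <= 2 -> size_bound n s.
Proof. by case: n => [|[|[]]]. Qed.

Lemma size_bound_linear n s : 2 < n -> size_bound n s -> 2 * n <= s + 3.
Proof. by rewrite /size_bound; case: ifP; nia. Qed.

Lemma size_bound_quadratic n s :
  9 <= n -> size_bound n s -> 4 * n <= (s + 3 - 2 * n) ^ 2.
Proof. by rewrite /size_bound; case: ifP; nia. Qed.

Lemma size_bound_pred n s t : size_bound n.-1 s -> s + 3 <= t -> size_bound n t.
Proof.
have [n10|n11] := leqP n 10; first by rewrite /size_bound n10 ifT; lia.
rewrite /size_bound (leqNgt n) n11 -!mulnn /=; set k := t + 3 - 2 * n.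
case: ifP => [n10|_] small st.
  have k8 : 8 <= k by lia.
  by have := leq_mul k8 k8; lia.
set j := s + 3 - 2 * n.-1 in small; have jk : j + 1 <= k by lia.
have j2 : 2 <= j by nia.
by have := leq_mul jk jk; nia.
Qed.

Lemma size_bound_split_large n a s s' : 10 < n -> size_bound (n - a) s' ->
  s' + 2 * a + 2 <= s -> (2 < a -> 2 * a <= s + 3 - 2 * n) -> size_bound n s.
Proof.
move=> n10 small st; rewrite /size_bound (leqNgt n) n10 /=.
set k := s + 3 - 2 * n => ak; move: small; rewrite /size_bound -!mulnn.
case: ifP => [na|_] small.
  have kn : n - a - 1 <= k by lia.
  have [a3|a4] := leqP a 3.
    have k7 : 7 <= k by lia.
    by have := leq_mul k7 kn; lia.
  have {}ak := ak (ltnW a4); have k8 : 8 <= k by lia.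
  by have := leq_mul k8 ak; lia.
set k' := s' + 3 - 2 * (n - a) in small.
have kk : k' + 2 <= k by nia.
have [ak'|ak'] := leqP a (k' + 1).
  by have := leq_mul kk kk; nia.
have {}ak : 2 * a <= k by nia.
by have := leq_mul ak ak; nia.
Qed.

(* The disjunction matters only for [n = 10] and [a = 3]. *)
Lemma size_bound_split n a s s' s'' :
  0 < a <= n -> size_bound (n - a) s' -> size_bound a s'' ->
  s' + 2 * a + 2 <= s -> s'' + 2 * n <= s ->
  (s' + 2 * a + 3 <= s) || (s'' + 2 * n + 2 <= s) -> size_bound n s.
Proof.
move=> /andP[a0 an] bound' bound'' st' st'' slack.
have [n10|n10] := leqP n 10.
  by move: bound' bound''; rewrite /size_bound !ifT; lia.
apply: size_bound_split_large n10 bound' st' _ => a2.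
by have := size_bound_linear a2 bound''; lia.
Qed.

(** * Implication graphs of 2-CNF formulas *)

Lemma exists_notin (T : eqType) (s r : seq T) :
  uniq s -> size r < size s -> exists2 x, x \in s & x \notin r.
Proof.
move=> us rs; apply/hasP; apply: contraLR rs; rewrite -all_predC -leqNgt => /allP sr.
by apply: (uniq_leq_size us) => x /sr; rewrite /= negbK.
Qed.

Lemma in_rem_uniq (T : eqType) (s : seq T) x y :
  uniq s -> (y \in rem x s) = (y != x) && (y \in s).
Proof. by move=> us; rewrite (mem_rem_uniq _ us) inE. Qed.

Section TwoCnf.
Variable V : finType.
Implicit Types (a : V -> bool) (l m p u w z : literal V).
Implicit Types (c : literal V * literal V) (ls ds zs : seq (literal V)).

Definition neg l : literal V := (l.1, ~~ l.2).

Definition majority a1 a2 a3 : V -> bool :=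
  fun v => [|| a1 v && a2 v, a1 v && a3 v | a2 v && a3 v].

Definition set_true a l : V -> bool := fun v => if v == l.1 then l.2 else a v.

Lemma negK : involutive neg.
Proof. by case=> v b; rewrite /neg /= negbK. Qed.

Lemma neg_inj : injective neg.
Proof. exact: can_inj negK. Qed.

Lemma neg_eq l m : (neg l == m) = (l == neg m).
Proof. exact: (can2_eq negK negK). Qed.

Lemma eval_neg a l : eval_lit a (neg l) = ~~ eval_lit a l.
Proof. by case: l => v b; rewrite /eval_lit /=; case: (a v); case: b. Qed.

Lemma eval_majority a1 a2 a3 l : eval_lit (majority a1 a2 a3) l =
  [|| eval_lit a1 l && eval_lit a2 l, eval_lit a1 l && eval_lit a3 l
    | eval_lit a2 l && eval_lit a3 l].
Proof.
case: l => v b; rewrite /eval_lit /majority /=.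
by case: b; case: (a1 v); case: (a2 v); case: (a3 v).
Qed.

Lemma eval_set_true a l m :
  eval_lit (set_true a l) m = (m == l) || (m != neg l) && eval_lit a m.
Proof.
case: l m => [v b] [w d]; rewrite /eval_lit /set_true /neg /= !xpair_eqE.
by case: (eqVneq w v) => // _; case: b; case: d.
Qed.

Lemma eval_set_true_mono a l m :
  m != neg l -> eval_lit a m -> eval_lit (set_true a l) m.
Proof. by rewrite eval_set_true => -> ->; rewrite orbT. Qed.

Lemma eval_set_true_id a l : eval_lit (set_true a l) l.
Proof. by rewrite eval_set_true eqxx. Qed.

Definition occurs l c := (c.1 == l) || (c.2 == l).
Definition partner l c := if c.1 == l then c.2 else c.1.
Definition eval_clause a c := eval_lit a c.1 || eval_lit a c.2.

Lemma occurs_partnerE l c : occurs l c ->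
  c = (l, partner l c) \/ c = (partner l c, l).
Proof.
case: c => c1 c2; rewrite /occurs /partner /=.
by case: (eqVneq c1 l) => [-> _|_ /= /eqP->]; [left | right].
Qed.

Lemma eval_clause_partner a l c : occurs l c ->
  eval_clause a c = eval_lit a l || eval_lit a (partner l c).
Proof. by case/occurs_partnerE => {1}->; rewrite /eval_clause //= orbC. Qed.

Lemma eval_clause_occurs a l c : occurs l c -> eval_lit a l -> eval_clause a c.
Proof. by move=> /eval_clause_partner-> ->. Qed.

Lemma occurs_partner l c : occurs l c -> occurs (partner l c) c.
Proof. by case/occurs_partnerE => {2}->; rewrite /occurs /= eqxx ?orbT. Qed.

Lemma partner_eq l m c : occurs l c -> occurs m c -> l != m -> partner l c = m.
Proof.
move=> /occurs_partnerE[]->; rewrite /occurs /partner /= => h.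
  by move/negbTE; rewrite eqxx => lm; move: h; rewrite lm => /eqP.
by move/negbTE => lm; move: h; rewrite lm orbF => /eqP->; rewrite eq_sym lm.
Qed.

(* Restricting a formula turns some clauses into units, which stop counting
   towards its size. *)
Record formula := Formula {
  units : seq (literal V); clauses : seq (literal V * literal V) }.
Implicit Types phi : formula.

Definition nclauses phi := size (clauses phi).

Definition satisfies a phi :=
  all (eval_lit a) (units phi) && all (eval_clause a) (clauses phi).

Definition consistent phi ls := exists2 a, satisfies a phi & all (eval_lit a) ls.

Definition entails phi l m :=
  forall a, satisfies a phi -> eval_lit a l -> eval_lit a m.

(* The clause [~ l \/ m] is an edge from [l] to [m] of the implication graph. *)
Definition outdeg phi l := count (occurs (neg l)) (clauses phi).
Definition succs phi l :=
  [seq partner (neg l) c | c <- clauses phi & occurs (neg l) c].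

Lemma satisfiesP a phi : reflect
  ({in units phi, forall l, eval_lit a l} /\
   {in clauses phi, forall c, eval_clause a c})
  (satisfies a phi).
Proof. by apply: (iffP andP) => -[/allP ? /allP ?]; split=> //; apply/allP. Qed.

Lemma satisfies_majority phi a1 a2 a3 : satisfies a1 phi -> satisfies a2 phi ->
  satisfies a3 phi -> satisfies (majority a1 a2 a3) phi.
Proof.
move=> /satisfiesP[g1 f1] /satisfiesP[g2 f2] /satisfiesP[g3 f3].
apply/satisfiesP; split=> [l lG|c cF]; first by rewrite eval_majority g1 ?g2.
move: (f1 c cF) (f2 c cF) (f3 c cF); rewrite /eval_clause !eval_majority.
by do 2!case: (eval_lit a1 _); do 2!case: (eval_lit a2 _); do 2!case: (eval_lit a3 _).
Qed.

Lemma consistentS phi ls ls' :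
  {subset ls' <= ls} -> consistent phi ls -> consistent phi ls'.
Proof.
by move=> sub [a aphi /allP als]; exists a => //; apply/allP => l /sub; apply: als.
Qed.

Lemma consistent_helly phi As Bs Cs : consistent phi (As ++ Bs) ->
  consistent phi (As ++ Cs) -> consistent phi (Bs ++ Cs) ->
  consistent phi (As ++ Bs ++ Cs).
Proof.
case=> a1 m1 + [a2 m2 + [a3 m3]]; rewrite !all_cat.
move=> /andP[/allP A1 /allP B1] /andP[/allP A2 /allP C2] /andP[/allP B3 /allP C3].
exists (majority a1 a2 a3); first exact: satisfies_majority.
rewrite !all_cat; apply/and3P; split; apply/allP => l lin; rewrite eval_majority.
- by rewrite A1 // A2.
- by rewrite B1 // B3 // orbT.
- by rewrite C2 // C3 // !orbT.
Qed.

Lemma not_entails phi l m : ~ entails phi l m -> consistent phi [:: l; neg m].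
Proof.
apply: contra_notP => h a aphi al; apply: contra_notT h => am.
by exists a; rewrite //= al eval_neg am.
Qed.

Lemma entails_inconsistent phi l m :
  entails phi l m -> entails phi l (neg m) -> ~ consistent phi [:: l].
Proof.
move=> lm lnm [a aphi /andP[al _]].
by have := lnm a aphi al; rewrite eval_neg lm.
Qed.

Lemma succsP phi l m : reflect
  (exists c, [/\ c \in clauses phi, occurs (neg l) c & m = partner (neg l) c])
  (m \in succs phi l).
Proof.
apply: (iffP mapP) => [[c]|[c [cphi lc ->]]].
  by rewrite mem_filter => /andP[lc cphi] ->; exists c.
by exists c; rewrite // mem_filter lc.
Qed.

Lemma size_succs phi l : size (succs phi l) = outdeg phi l.
Proof. by rewrite size_map size_filter. Qed.

Lemma succs_nil phi l : outdeg phi l = 0 -> succs phi l = [::].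
Proof. by rewrite -size_succs; exact: size0nil. Qed.

Lemma outdeg_gt0 phi l c :
  c \in clauses phi -> occurs (neg l) c -> 0 < outdeg phi l.
Proof. by move=> cphi lc; rewrite -has_count; apply/hasP; exists c. Qed.

Lemma outdeg_neg_gt0 phi l m : m \in succs phi l -> 0 < outdeg phi (neg m).
Proof.
case/succsP => c [cphi lc ->]; apply: (outdeg_gt0 cphi).
by rewrite negK occurs_partner.
Qed.

Lemma succ_entails phi l m : m \in succs phi l -> entails phi l m.
Proof.
case/succsP => c [cphi lc ->] a /satisfiesP[_ /(_ c cphi)].
by rewrite (eval_clause_partner _ lc) eval_neg => /orP[/negP|].
Qed.

Lemma satisfies_set_true a phi l : satisfies a phi -> neg l \notin units phi ->
  all (eval_lit (set_true a l)) (succs phi l) -> satisfies (set_true a l) phi.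
Proof.
move=> /satisfiesP[aunits aclauses] lunits /allP asuccs.
apply/satisfiesP; split=> [m mphi|c cphi].
  apply: eval_set_true_mono; last exact: aunits.
  by apply: contraNneq lunits => <-.
have [lc|] := boolP (occurs (neg l) c).
  rewrite (eval_clause_partner _ lc); apply/orP; right.
  by apply: asuccs; apply/succsP; exists c.
rewrite negb_or => /andP[l1 l2]; have := aclauses _ cphi.
by rewrite /eval_clause => /orP[] /eval_set_true_mono->; rewrite ?orbT.
Qed.

Definition touched ds c := has (fun d => occurs (neg d) c) ds.

Definition falsify ds phi : formula :=
  Formula (map neg ds ++ units phi) (filter (predC (touched ds)) (clauses phi)).

Lemma satisfies_falsify a ds phi :
  satisfies a (falsify ds phi) = all (eval_lit a) (map neg ds) && satisfies a phi.
Proof.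
rewrite /satisfies all_cat -andbA; case: allP => //= ads; congr (_ && _).
rewrite all_filter; apply: eq_in_all => c cphi /=.
have [/hasP[d dds dc]|//] := boolP (touched ds c).
by rewrite (eval_clause_occurs dc) // ads ?map_f.
Qed.

Lemma consistent_falsify ds phi ls :
  consistent (falsify ds phi) ls <-> consistent phi (map neg ds ++ ls).
Proof.
split=> -[a]; rewrite ?satisfies_falsify ?all_cat.
  by move=> /andP[ads aphi] als; exists a; rewrite ?all_cat ?ads.
by move=> aphi /andP[ads als]; exists a; rewrite ?satisfies_falsify ?ads.
Qed.

Lemma nclauses_falsify ds phi :
  nclauses (falsify ds phi) + count (touched ds) (clauses phi) = nclauses phi.
Proof. by rewrite /nclauses size_filter addnC count_predC. Qed.

Lemma nclauses_falsify1 l phi :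
  nclauses (falsify [:: l] phi) + outdeg phi l = nclauses phi.
Proof.
rewrite -[RHS](nclauses_falsify [:: l]); congr (_ + _).
by apply: eq_count => c; rewrite /= orbF.
Qed.

Lemma outdeg_falsify_lt ds phi l c : c \in clauses phi -> occurs (neg l) c ->
  touched ds c -> outdeg (falsify ds phi) l < outdeg phi l.
Proof.
move=> cphi lc tc.
have splitE : outdeg phi l = count (predI (touched ds) (occurs (neg l))) (clauses phi)
    + outdeg (falsify ds phi) l.
  rewrite /outdeg -size_filter -(count_predC (touched ds)) count_filter; congr (_ + _).
  by rewrite !count_filter; apply: eq_count => x; rewrite /= andbC.
rewrite splitE -[X in X < _]add0n ltn_add2r -has_count.
by apply/hasP; exists c; rewrite //= tc.
Qed.

Lemma count_touched phi ds : uniq ds ->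
  {in clauses phi, forall c, {in ds &, forall d d',
     occurs (neg d) c -> occurs (neg d') c -> d = d'}} ->
  count (touched ds) (clauses phi) = \sum_(d <- ds) outdeg phi d.
Proof.
elim: ds => [|d ds IH] /=; first by rewrite big_nil count_pred0.
case/andP=> dds uds disj; rewrite big_cons -IH //; last first.
  by move=> c cphi x y xds yds; apply: disj; rewrite // inE ?xds ?yds orbT.
rewrite /outdeg -count_predUI [X in _ + X](_ : _ = 0) ?addn0 //.
apply/eqP; rewrite -leqn0 leqNgt -has_count; apply/hasPn => c cphi /=.
apply/negP => /andP[dc /hasP[x xds xc]]; case/negP: dds.
by rewrite (disj c cphi d x) // inE ?eqxx ?xds ?orbT.
Qed.

Definition drop_clause c phi : formula := Formula (units phi) (rem c (clauses phi)).

Section DropClause.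
Variables (phi : formula) (c : literal V * literal V).
Hypothesis cphi : c \in clauses phi.

Lemma satisfies_drop a :
  satisfies a phi = eval_clause a c && satisfies a (drop_clause c phi).
Proof. by rewrite /satisfies (perm_all _ (perm_to_rem cphi)) /= andbCA. Qed.

Lemma consistent_drop ls : consistent phi ls -> consistent (drop_clause c phi) ls.
Proof. by case=> a; rewrite satisfies_drop => /andP[_ ?]; exists a. Qed.

Lemma consistent_undrop l ls : occurs l c -> l \in ls ->
  consistent (drop_clause c phi) ls -> consistent phi ls.
Proof.
move=> lc lls [a aphi als]; exists a; rewrite // satisfies_drop aphi andbT.
exact: eval_clause_occurs lc (allP als _ lls).
Qed.

Lemma nclauses_drop : nclauses (drop_clause c phi) < nclauses phi.
Proof. by rewrite /nclauses (perm_size (perm_to_rem cphi)). Qed.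

Lemma outdeg_drop l : outdeg phi l = occurs (neg l) c + outdeg (drop_clause c phi) l.
Proof. by rewrite /outdeg (permP (perm_to_rem cphi)). Qed.

End DropClause.

(** * Mutually exclusive literals *)

Definition exclusive phi zs :=
  [/\ uniq zs, {in zs, forall z, consistent phi [:: z]}
    & {in zs &, forall z z', consistent phi [:: z; z'] -> z = z'}].

Lemma exclusiveS phi zs zs' :
  uniq zs' -> {subset zs' <= zs} -> exclusive phi zs -> exclusive phi zs'.
Proof.
move=> us' sub [_ cz ez]; split=> // [z /sub|z z' /sub zz /sub zz']; first exact: cz.
exact: ez.
Qed.

Lemma exclusive_cons phi p zs : exclusive phi zs -> consistent phi [:: p] ->
  {in zs, forall z, ~ consistent phi [:: p; z]} -> exclusive phi (p :: zs).
Proof.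
move=> [us cz ez] cp pz; split.
- rewrite /= us andbT; apply/negP => pzs; apply: (pz p pzs).
  by apply: consistentS cp => x; rewrite !inE orbb.
- by move=> z; rewrite inE => /orP[/eqP->//|]; exact: cz.
move=> z z'; rewrite !inE => /orP[/eqP->|zz] /orP[/eqP->|zz'] //; last exact: ez.
  by move/(pz _ zz').
by move=> h; case: (pz _ zz); apply: consistentS h => x; rewrite !inE orbC.
Qed.

Section Exclusive.
Variables (phi : formula) (zs : seq (literal V)).
Hypothesis exzs : exclusive phi zs.

Lemma exclusive_entails_neg z z' :
  z \in zs -> z' \in zs -> z != z' -> entails phi z (neg z').
Proof.
case: exzs => _ _ ez zz zz' /eqP ne a aphi az; rewrite eval_neg; apply/negP => az'.
by apply: ne; apply: ez => //; exists a; rewrite //= az az'.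
Qed.

Lemma exclusive_neg z : 2 < size zs -> z \in zs -> neg z \notin zs.
Proof.
case: exzs => us cz ez zs_gt2 zz; apply/negP => nz.
have [w wz] := @exists_notin _ zs [:: z; neg z] us zs_gt2.
rewrite !inE negb_or => /andP[wnz wnnz].
case: (entails_inconsistent (exclusive_entails_neg wz zz wnz) _ (cz _ wz)).
exact: exclusive_entails_neg.
Qed.

Lemma exclusive_notin_units z : 1 < size zs -> z \in zs -> z \notin units phi.
Proof.
case: exzs => us cz ez zs_gt1 zz; apply/negP => zphi.
have [w wz] := @exists_notin _ zs [:: z] us zs_gt1; rewrite inE => wnz.
apply: (entails_inconsistent _ (exclusive_entails_neg wz zz wnz) (cz _ wz)).
by move=> a /satisfiesP[/(_ _ zphi)].
Qed.

Lemma exclusive_neg_notin_units z : z \in zs -> neg z \notin units phi.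
Proof.
case: exzs => us cz ez zz; apply/negP => zphi.
apply: (@entails_inconsistent phi z z _ _ (cz _ zz)) => // a /satisfiesP[aphi _] _.
exact: aphi.
Qed.

Lemma exclusive_falsify ds :
  {in zs, forall z, consistent phi (map neg ds ++ [:: z])} ->
  exclusive (falsify ds phi) zs.
Proof.
case: exzs => us _ ez cz; split=> // [z zz|z z' zz zz' /consistent_falsify h].
  by apply/consistent_falsify/cz.
by apply: ez => //; apply: consistentS h => x; rewrite mem_cat orbC => ->.
Qed.

Lemma exclusive_drop c l : c \in clauses phi -> occurs l c ->
  {in zs, forall z, occurs z c \/ entails phi z l} -> exclusive (drop_clause c phi) zs.
Proof.
case: exzs => us cz ez cphi lc zl; split=> // [z /cz|y y' yz yz' cyy'].
  exact: consistent_drop.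
have undrop m ls : occurs m c -> m \in ls -> {subset [:: y; y'] <= ls} ->
    consistent (drop_clause c phi) ls -> y = y'.
  by move=> mc mls sub /(consistent_undrop cphi mc mls)/(consistentS sub)/ez; apply.
have [yc|yl] := zl _ yz; first by apply: undrop yc _ _ cyy'; rewrite ?mem_head.
have [yc'|yl'] := zl _ yz'.
  by apply: undrop yc' _ _ cyy'; rewrite // !inE eqxx orbT.
have cl z : z \in zs -> entails phi z l -> consistent (drop_clause c phi) [:: z; l].
  move=> /cz[a aphi /andP[az _]] /(_ a aphi az) al.
  by apply: consistent_drop => //; exists a; rewrite //= az al.
apply: undrop lc _ _ (consistent_helly (As := [:: y]) cyy' (cl _ yz yl) (cl _ yz' yl')).
  by rewrite !inE eqxx !orbT.
by move=> x; rewrite /= !inE orbA => ->.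
Qed.

End Exclusive.

Lemma exclusive_remove phi zs z : exclusive phi zs -> z \in zs ->
  exclusive (falsify [:: z] phi) (rem z zs).
Proof.
move=> exzs zz; have [us cz _] := exzs.
apply: exclusive_falsify => [|y].
  by apply: exclusiveS exzs; [exact: rem_uniq | exact: mem_rem].
rewrite in_rem_uniq // => /andP[yz yzs]; have [a aphi /andP[ay _]] := cz _ yzs.
by exists a => //=; rewrite (exclusive_entails_neg exzs yzs zz) ?ay.
Qed.

(* An input occurring positively is redundant there: every other input already
   makes the other literal of the clause true. *)
Lemma exclusive_drop_positive phi zs c z : exclusive phi zs -> z \in zs ->
  c \in clauses phi -> occurs z c -> exclusive (drop_clause c phi) zs.
Proof.
move=> exzs zz cphi zc; apply: (exclusive_drop exzs cphi (occurs_partner zc)) => y yz.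
have [->|yz'] := eqVneq y z; [by left | right] => a aphi ay.
have /satisfiesP[_ /(_ c cphi)] := aphi; rewrite (eval_clause_partner _ zc).
have := exclusive_entails_neg exzs yz zz yz' aphi ay.
by rewrite eval_neg => /negbTE->.
Qed.

Lemma exclusive_succ_false phi zs z w a : exclusive phi zs -> 2 < size zs ->
  z \in zs -> w \in zs -> w != z -> satisfies a phi -> eval_lit a w ->
  ~~ all (eval_lit (set_true a z)) (succs phi z).
Proof.
move=> exzs zs_gt2 zz wz wnz aphi aw; apply/negP => asuccs.
have [_ _ ez] := exzs; case/eqP: wnz; apply: ez => //; exists (set_true a z).
  exact: satisfies_set_true aphi (exclusive_neg_notin_units exzs zz) asuccs.
rewrite /= eval_set_true_id andbT eval_set_true_mono //.
by apply: contraTneq wz => ->; exact: (exclusive_neg exzs).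
Qed.

Lemma exclusive_replace phi zs z : exclusive phi zs -> 2 < size zs -> z \in zs ->
  outdeg phi z <= 1 -> exists phi' zs',
    [/\ exclusive phi' zs', size zs' = size zs & nclauses phi' < nclauses phi].
Proof.
move=> exzs zs_gt2 zz; have [us cz ez] := exzs; rewrite -size_succs.
have falsified := exclusive_succ_false exzs zs_gt2 zz.
case Es: (succs phi z) => [|p []] // _.
  have [w wz] := @exists_notin _ zs [:: z] us (ltnW zs_gt2); rewrite inE => wnz.
  have [a aphi /andP[aw _]] := cz _ wz.
  by have := falsified w a wz wnz aphi aw; rewrite Es.
have zp : entails phi z p by apply: succ_entails; rewrite Es mem_head.
have /succsP[c [cphi zc pE]] : p \in succs phi z by rewrite Es mem_head.
have exrem : exclusive (drop_clause c phi) (rem z zs).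
  apply: (exclusive_drop _ cphi zc) => [|y].
    by apply: exclusiveS exzs; [exact: rem_uniq | exact: mem_rem].
  rewrite in_rem_uniq // => /andP[yz yzs]; right.
  exact: (exclusive_entails_neg exzs).
exists (drop_clause c phi), (p :: rem z zs); split; last exact: nclauses_drop.
  apply: exclusive_cons exrem _ _ => [|y].
    apply: consistent_drop => //; have [a aphi /andP[az _]] := cz _ zz.
    by exists a; rewrite //= zp.
  rewrite in_rem_uniq // => /andP[ynz yz].
  case/(consistent_undrop cphi (occurs_partner zc)); first by rewrite -pE mem_head.
  move=> a aphi /and3P[ap ay _]; have := falsified y a yz ynz aphi ay.
  rewrite Es /= andbT eval_set_true_mono //; apply/eqP => pnz.
  by apply: (@entails_inconsistent phi z z _ _ (cz _ zz)); rewrite -?pnz.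
by rewrite /= size_rem // prednK //; case: (zs) zz.
Qed.

Lemma exclusive_pure phi zs u : exclusive phi zs -> neg u \notin zs ->
  neg u \notin units phi -> outdeg phi u = 0 -> exclusive (falsify [:: neg u] phi) zs.
Proof.
move=> exzs uz uphi out0; apply: (exclusive_falsify exzs) => z zz.
have [_ cz _] := exzs; have [a aphi /andP[az _]] := cz _ zz.
exists (set_true a u); first by apply: satisfies_set_true; rewrite // (succs_nil out0).
rewrite /= negK eval_set_true_id eval_set_true_mono //.
by apply: contraNneq uz => <-.
Qed.

Section Substitution.
Variables u w : literal V.

Definition subst_lit l := if l == u then w else l.

Definition subst_formula phi : formula :=
  Formula (map subst_lit (units phi))
    [seq (subst_lit c.1, subst_lit c.2) | c <- clauses phi].

Definition copy_value a := set_true a (if eval_lit a w then u else neg u).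

Lemma eval_subst a l :
  l != neg u -> eval_lit (copy_value a) l = eval_lit a (subst_lit l).
Proof.
rewrite /copy_value /subst_lit => lu.
by case aw: (eval_lit a w); rewrite eval_set_true ?negK (negbTE lu) /=; case: eqP.
Qed.

Lemma satisfies_subst phi a : neg u \notin units phi -> outdeg phi u = 0 ->
  satisfies a (subst_formula phi) = satisfies (copy_value a) phi.
Proof.
move=> uphi /eqP; rewrite eqn0Ngt -has_count => /hasPn uclauses.
rewrite /satisfies !all_map; congr (_ && _).
  by apply: eq_in_all => l lphi /=; rewrite eval_subst //; apply: contraNneq uphi => <-.
apply: eq_in_all => c /uclauses; rewrite negb_or => /andP[u1 u2] /=.
by rewrite /eval_clause !eval_subst.
Qed.

Lemma satisfies_subst_entailed phi a : (eval_lit a u -> eval_lit a w) ->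
  satisfies a phi -> satisfies a (subst_formula phi).
Proof.
move=> uw; have esubst l : eval_lit a l -> eval_lit a (subst_lit l).
  by rewrite /subst_lit; case: eqP => // ->.
rewrite /satisfies !all_map => /andP[/allP aunits /allP aclauses].
apply/andP; split; apply/allP => x xphi /=; first exact/esubst/aunits.
by have := aclauses x xphi; rewrite /eval_clause => /orP[] /esubst->; rewrite ?orbT.
Qed.

End Substitution.

Lemma exclusive_subst phi zs u c : exclusive phi zs ->
  u \notin zs -> neg u \notin zs -> consistent phi [:: u] ->
  c \in clauses phi -> occurs (neg u) c -> outdeg phi u = 1 ->
  exclusive (subst_formula u (partner (neg u) c) (drop_clause c phi)) zs.
Proof.
move=> [us cz ez] uz nuz [b bphi /andP[bu _]] cphi uc out1.
set w := partner _ c.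
have uw : entails phi u w by apply: succ_entails; apply/succsP; exists c.
have wnu : w != neg u.
  by apply: contraTneq (uw _ bphi bu) => ->; rewrite eval_neg bu.
have substE z : z \in zs -> subst_lit u w z = z /\ z != neg u.
  move=> zz; split; last by apply: contraNneq nuz => <-.
  by rewrite /subst_lit; case: eqP zz uz => [-> ->|].
have uphi : neg u \notin units (drop_clause c phi).
  by apply/negP; case/satisfiesP: bphi => bphi _ /bphi; rewrite eval_neg bu.
have out0 : outdeg (drop_clause c phi) u = 0.
  by move: out1; rewrite (outdeg_drop cphi) uc => -[].
have lift a : satisfies a (subst_formula u w (drop_clause c phi)) ->
    satisfies (copy_value u w a) phi.
  rewrite satisfies_subst // (satisfies_drop cphi) => ->; rewrite andbT.
  have [aw|/negbTE aw] := boolP (eval_lit a w).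
    rewrite (eval_clause_partner _ uc) -/w (eval_subst _ _ wnu).
    by rewrite /subst_lit if_same aw orbT.
  by apply: (eval_clause_occurs uc); rewrite /copy_value aw eval_set_true_id.
split=> // [z zz|z z' zz zz' [a aphi /and3P[az az' _]]].
  have [a aphi az] := cz _ zz; exists a => //.
  apply: satisfies_subst_entailed; first exact: uw.
  by move: aphi; rewrite (satisfies_drop cphi) => /andP[].
have [[ez1 nz] [ez2 nz']] := (substE _ zz, substE _ zz').
apply: ez => //; exists (copy_value u w a); first exact: lift.
by rewrite /= !eval_subst // ez1 ez2 az az'.
Qed.

Lemma exclusive_eliminate phi zs u : exclusive phi zs ->
  u \notin zs -> neg u \notin zs ->
  consistent phi [:: u] -> 0 < outdeg phi (neg u) -> outdeg phi u <= 1 ->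
  exists2 phi', exclusive phi' zs & nclauses phi' < nclauses phi.
Proof.
move=> exzs uz nuz cu in_gt0; rewrite leq_eqVlt ltnS leqn0 => /orP[/eqP out1|/eqP out0].
  have /hasP[c cphi uc] : has (occurs (neg u)) (clauses phi).
    by rewrite has_count -/(outdeg _ _) out1.
  exists (subst_formula u (partner (neg u) c) (drop_clause c phi)); last first.
    by rewrite {1}/nclauses size_map; exact: nclauses_drop.
  exact: exclusive_subst.
exists (falsify [:: neg u] phi); last first.
  by have := nclauses_falsify1 (neg u) phi; lia.
apply: exclusive_pure => //; case: cu => a /satisfiesP[aphi _] /andP[au _].
by apply/negP => /aphi; rewrite eval_neg au.
Qed.

(* A clause contributes to the outdegrees of at most two literals. *)
Lemma leq_size_outdeg phi zs d : uniq zs ->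
  {in zs, forall z, d <= outdeg phi z} -> size zs * d <= nclauses phi * 2.
Proof.
move=> us le_outdeg.
have le_sum : size zs * d <= \sum_(z <- zs) outdeg phi z.
  rewrite -sum1_size big_distrl /= big_seq [X in _ <= X]big_seq.
  by apply: leq_sum => z zz; rewrite mul1n le_outdeg.
apply: leq_trans le_sum _; rewrite /nclauses -sum1_size big_distrl /=.
under eq_bigr do rewrite /outdeg -sum1_count big_mkcond.
rewrite exchange_big; apply: leq_sum => c _; rewrite -big_mkcond sum1_count.
rewrite -size_filter -(size_map neg); apply: (@uniq_leq_size _ _ [:: c.1; c.2]).
  by rewrite (map_inj_uniq neg_inj) filter_uniq.
by move=> _ /mapP[z + ->]; rewrite mem_filter !inE ![neg z == _]eq_sym => /andP[].
Qed.

(** * Irreducible families *)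

Definition reducible phi zs := exists phi' zs', exclusive phi' zs' /\
  (size zs' = size zs /\ nclauses phi' < nclauses phi \/
   size zs' = (size zs).-1 /\ nclauses phi' + 3 <= nclauses phi).

Lemma reducible_outdeg_le1 phi zs z : exclusive phi zs -> 2 < size zs -> z \in zs ->
  outdeg phi z <= 1 -> reducible phi zs.
Proof.
move=> exzs zs_gt2 zz /(exclusive_replace exzs zs_gt2 zz)[phi' [zs' [exzs' ? ?]]].
by exists phi', zs'; split=> //; left.
Qed.

Lemma reducible_outdeg_ge3 phi zs z : exclusive phi zs -> z \in zs ->
  2 < outdeg phi z -> reducible phi zs.
Proof.
move=> exzs zz out3; exists (falsify [:: z] phi), (rem z zs).
split; [exact: exclusive_remove | right; rewrite size_rem //; split=> //].
by have := nclauses_falsify1 z phi; lia.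
Qed.

Lemma reducible_remove phi zs z phi' zs' : 1 < outdeg phi z ->
  exclusive phi' zs' -> size zs' = (size zs).-1 ->
  nclauses phi' < nclauses (falsify [:: z] phi) -> reducible phi zs.
Proof.
move=> out2 exzs' szs' lt; exists phi', zs'; split=> //; right; split=> //.
by have := nclauses_falsify1 z phi; lia.
Qed.

Section Irreducible.
Variables (phi : formula) (zs : seq (literal V)).
Hypothesis exzs : exclusive phi zs.
Hypothesis zs_gt3 : 3 < size zs.
Hypothesis irr : ~ reducible phi zs.

Lemma irreducible_outdeg z : z \in zs -> outdeg phi z = 2.
Proof.
move=> zz; apply/eqP; rewrite eqn_leq.
apply/andP; split; rewrite leqNgt; apply/negP => out.
  exact: irr (reducible_outdeg_ge3 exzs zz out).
exact: irr (reducible_outdeg_le1 exzs (ltnW zs_gt3) zz out).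
Qed.

Lemma irreducible_outdeg_neg z : z \in zs -> outdeg phi (neg z) = 0.
Proof.
move=> zz; apply/eqP; rewrite eqn0Ngt -has_count; apply/negP => /hasP[c cphi].
rewrite negK => zc; apply: irr; exists (drop_clause c phi), zs.
split; first exact: exclusive_drop_positive zz cphi zc.
by left; split; rewrite // nclauses_drop.
Qed.

Lemma irreducible_disjoint c z z' : c \in clauses phi -> z \in zs -> z' \in zs ->
  occurs (neg z) c -> occurs (neg z') c -> z = z'.
Proof.
move=> cphi zz zz' zc z'c; apply: contra_notP irr => /eqP zz'ne; have [us _ _] := exzs.
have exrem := exclusive_remove exzs zz'.
have srem : size (rem z' zs) = (size zs).-1 by rewrite size_rem.
have outz : outdeg (falsify [:: z'] phi) z <= 1.
  rewrite -ltnS -(irreducible_outdeg zz).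
  by apply: outdeg_falsify_lt zc _; rewrite //= z'c.
have zrem : z \in rem z' zs by rewrite in_rem_uniq ?zz'ne.
have [|phi' [zs' [exzs' szs' lt]]] := exclusive_replace exrem _ zrem outz.
  by rewrite srem; lia.
by apply: reducible_remove exzs' _ lt; rewrite ?irreducible_outdeg ?szs'.
Qed.

Lemma sum_outdeg_inputs ds : {subset ds <= zs} ->
  \sum_(d <- ds) outdeg phi d = 2 * size ds.
Proof.
move=> sub; rewrite -sum1_size big_distrr /=.
by apply: eq_big_seq => z /sub /irreducible_outdeg->.
Qed.

Lemma succ_notin_inputs z p : z \in zs -> p \in succs phi z ->
  (p \notin zs) * (neg p \notin zs).
Proof.
move=> zz psucc; split; apply/negP => pz.
  by have := outdeg_neg_gt0 psucc; rewrite irreducible_outdeg_neg.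
have /succsP[c [cphi zc pE]] := psucc.
have zE : z = neg p.
  by apply: (irreducible_disjoint cphi zz pz zc); rewrite negK pE occurs_partner.
have [_ cz _] := exzs; apply: (@entails_inconsistent phi z z _ _ (cz _ zz)) => //.
by rewrite {2}zE negK; exact: succ_entails.
Qed.

Lemma satisfies_set_input a z : z \in zs -> satisfies a phi ->
  all (eval_lit a) (succs phi z) -> satisfies (set_true a z) phi.
Proof.
move=> zz aphi /allP asuccs; apply: satisfies_set_true => //.
  exact: (exclusive_neg_notin_units exzs).
apply/allP => p psucc; apply: eval_set_true_mono; last exact: asuccs.
by rewrite -neg_eq; apply: contraTneq (zz) => <-; rewrite (succ_notin_inputs zz psucc).
Qed.

Lemma consistent_inputs_off ls : {in ls, forall l, l \notin zs} ->
  consistent phi ls -> consistent phi (map neg zs ++ ls).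
Proof.
move=> lszs cls; have : {subset zs <= zs} by [].
elim: {1 3}zs => //= d ds IH sub.
have dz : d \in zs by rewrite sub ?mem_head.
have [|a aphi] := IH; first by move=> x xds; rewrite sub // inE xds orbT.
rewrite all_cat => /andP[/allP ads /allP als].
have keep l : l != d -> eval_lit a l -> eval_lit (set_true a (neg d)) l.
  by move=> ld; apply: eval_set_true_mono; rewrite negK.
exists (set_true a (neg d)).
  apply: satisfies_set_true => //.
    by rewrite negK (exclusive_notin_units exzs) //; lia.
  by rewrite (succs_nil (irreducible_outdeg_neg dz)).
rewrite /= eval_set_true_id /= all_cat.
apply/andP; split; apply/allP => l lin; apply: keep.
- case/mapP: lin => x xds ->; rewrite neg_eq; apply: contraTneq (dz) => xE.
  rewrite -[d]negK -xE; apply: (exclusive_neg exzs); first exact: ltnW.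
  by rewrite sub // inE xds orbT.
- exact: ads.
- by apply: contraTneq dz => <-; exact: lszs.
- exact: als.
Qed.

Lemma succs_pair z : z \in zs -> exists p q, succs phi z = [:: p; q].
Proof.
move=> /irreducible_outdeg; rewrite -size_succs.
by case: (succs phi z) => [|p [|q []]] // _; exists p, q.
Qed.

Lemma entailing_succ z u : z \in zs -> u \notin zs -> entails phi z u ->
  exists2 p, p \in succs phi z & entails phi p u.
Proof.
move=> zz uzs zu; have [p [q succsE]] := succs_pair zz.
have [_ cz _] := exzs; have [b bphi /andP[bz _]] := cz _ zz.
have zsucc r : r \in [:: p; q] -> eval_lit b r.
  by rewrite -succsE => /succ_entails; apply.
apply: contrapT => none.
have cnot r : r \in [:: p; q] -> consistent phi [:: r; neg u].
  by move=> rpq; apply: not_entails => ru; apply: none; exists r; rewrite ?succsE.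
have cpq : consistent phi [:: p; q].
  by exists b; rewrite //= !zsucc // !inE eqxx ?orbT.
have [] := consistent_helly (As := [:: p]) (Bs := [:: q]) cpq (cnot p _) (cnot q _).
- exact: mem_head.
- by rewrite !inE eqxx orbT.
move=> a aphi /and4P[ap aq au _].
have := zu _ (satisfies_set_input zz aphi _) (eval_set_true_id a z).
rewrite succsE /= ap aq => /(_ isT); rewrite eval_set_true.
case: eqP => [uz|_]; first by rewrite uz zz in uzs.
by case/andP => _ /negPn; rewrite -eval_neg au.
Qed.

Definition entailing u := [seq z <- zs | `[< entails phi z u >]].

Lemma mem_entailing u z : reflect (z \in zs /\ entails phi z u) (z \in entailing u).
Proof. by rewrite mem_filter andbC; apply: (iffP andP) => -[? /asboolP]. Qed.

Lemma entailing_uniq u : uniq (entailing u).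
Proof. by have [us _ _] := exzs; rewrite filter_uniq. Qed.

Lemma entailing_sub u : {subset entailing u <= zs}.
Proof. by move=> z /mem_entailing[]. Qed.

Lemma exclusive_not_entailing u :
  exclusive (falsify (u :: entailing u) phi) (filter (predC (mem (entailing u))) zs).
Proof.
have [us _ _] := exzs; apply: exclusive_falsify => [|z].
  apply: exclusiveS exzs; first exact: filter_uniq.
  by move=> z; rewrite mem_filter => /andP[].
rewrite mem_filter => /andP[/= /mem_entailing zu zz].
have [|a aphi /and3P[az au _]] := @not_entails phi z u.
  by move=> zu'; apply: zu.
exists a => //; rewrite /= all_cat /= az au !andbT /=.
apply/allP => _ /mapP[y /mem_entailing[yz yu] ->].
by rewrite eval_neg; apply: contraL au => ay; rewrite eval_neg negbK; exact: yu.
Qed.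

Lemma size_not_entailing u :
  size (filter (predC (mem (entailing u))) zs) + size (entailing u) = size zs.
Proof.
rewrite -(count_predC (mem (entailing u)) zs) addnC size_filter; congr (_ + _).
by rewrite size_filter; apply: eq_in_count => z zz; rewrite /= mem_filter zz andbT.
Qed.

Lemma leq_nclauses_falsify_inputs u :
  nclauses (falsify (u :: zs) phi) + 2 * size zs <= nclauses phi.
Proof.
have [us _ _] := exzs; rewrite -[X in _ <= X](nclauses_falsify (u :: zs)) leq_add2l.
have -> : 2 * size zs = count (touched zs) (clauses phi).
  rewrite count_touched ?sum_outdeg_inputs // => c cphi x y xz yz.
  exact: irreducible_disjoint.
by apply: sub_count => c /=; rewrite orbC => ->.
Qed.

Definition inputs_succs := flatten [seq succs phi z | z <- zs].

Definition source u := [/\ u \in inputs_succs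
  & {in inputs_succs, forall p, size (entailing u) <= size (entailing p)}].

Lemma exists_source : exists u, source u.
Proof.
have [_ cz _] := exzs.
have [z zz] : exists z, z \in zs.
  by case: (zs) zs_gt3 => // z ? _; exists z; exact: mem_head.
have [p [q succsE]] := succs_pair zz.
have pin : p \in inputs_succs.
  by apply/flatten_mapP; exists z; rewrite // succsE mem_head.
exists [arg min_(v < p in inputs_succs) size (entailing v)].
by case: arg_minnP.
Qed.

Section Source.
Variable u : literal V.
Hypothesis source_u : source u.

Lemma source_succ : exists2 z, z \in zs & u \in succs phi z.
Proof. by case: source_u => /flatten_mapP. Qed.

Lemma source_notin_inputs : (u \notin zs) * (neg u \notin zs).
Proof. by have [z zz] := source_succ; exact: succ_notin_inputs. Qed.

Lemma entailing_source_gt0 : 0 < size (entailing u).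
Proof.
have [z zz /succ_entails zu] := source_succ.
suff : z \in entailing u by case: (entailing u).
exact/mem_entailing.
Qed.

Lemma source_entailed z z' p : z \in zs -> p \in succs phi z -> entails phi p u ->
  z' \in entailing u -> entails phi z' p.
Proof.
move=> zz psucc pu z'u; have [_ umin] := source_u.
have sub : {subset entailing p <= entailing u}.
  move=> y /mem_entailing[yz yp]; apply/mem_entailing; split=> // a aphi ay.
  by apply: pu => //; exact: yp.
have pin : p \in inputs_succs by apply/flatten_mapP; exists z.
have [_ eqpu] := uniq_min_size (entailing_uniq p) sub (umin p pin).
by have := z'u; rewrite -eqpu => /mem_entailing[].
Qed.

Lemma count_touched_source ds : uniq ds -> {subset ds <= zs} ->
  {in ds, forall z, neg u \notin succs phi z} ->
  count (touched (u :: ds)) (clauses phi) = outdeg phi u + 2 * size ds.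
Proof.
move=> uds sub nsucc; have [unz nunz] := source_notin_inputs.
have disj c z : c \in clauses phi -> z \in ds ->
    occurs (neg u) c -> occurs (neg z) c -> False.
  move=> cphi zds uc zc; case/negP: (nsucc z zds); apply/succsP; exists c; split=> //.
  apply/esym/partner_eq => //; rewrite (inj_eq neg_inj).
  by apply: contraNneq unz => <-; exact: sub.
rewrite count_touched.
- by rewrite big_cons sum_outdeg_inputs.
- by rewrite /= uds andbT; apply: contra unz; exact: sub.
move=> c cphi x y; rewrite !inE => /orP[/eqP->|xds] /orP[/eqP->|yds] xc yc //.
- by case: (disj c y).
- by case: (disj c x).
by apply: (irreducible_disjoint cphi); rewrite ?sub.
Qed.

Lemma nclauses_falsify_entailing :
  nclauses (falsify (u :: entailing u) phi) + 2 * size (entailing u) + outdeg phi u =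
  nclauses phi.
Proof.
rewrite -addnA [_ + outdeg _ _]addnC -count_touched_source ?nclauses_falsify //.
- exact: entailing_uniq.
- exact: entailing_sub.
move=> z /mem_entailing[zz zu]; have [_ cz _] := exzs.
apply/negP => /succ_entails znu; exact: entails_inconsistent zu znu (cz _ zz).
Qed.

Lemma source_outdeg_gt1 : 1 < outdeg phi u.
Proof.
rewrite ltnNge; apply/negP => out1; apply: irr.
have [unz nunz] := source_notin_inputs; have [z zz zu] := source_succ.
have [_ cz _] := exzs; have [a aphi /andP[az _]] := cz _ zz.
have [||phi' exphi' lt] := exclusive_eliminate exzs unz nunz _ _ out1.
- by exists a => //=; rewrite (succ_entails zu).
- exact: outdeg_neg_gt0 zu.
by exists phi', zs; split=> //; left.
Qed.

Lemma source_outdeg_gt2 : neg u \in inputs_succs -> 2 < outdeg phi u.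
Proof.
case/flatten_mapP => z zz znu; rewrite ltnNge; apply/negP => out2; apply: irr.
have [unz nunz] := source_notin_inputs; have [us cz _] := exzs.
have [w wz wu] := source_succ; have [b bphi /andP[bw _]] := cz _ wz.
have wnz : w != z.
  apply: contraPneq (cz _ wz) => wE; apply: entails_inconsistent (succ_entails wu) _.
  by rewrite wE; exact: succ_entails.
have /succsP[c [cphi zc nuE]] := znu; have /succsP[d [dphi wd uE]] := wu.
have sub := @mem_rem _ z zs.
have [] := @exclusive_eliminate (falsify [:: z] phi) (rem z zs) u.
- exact: exclusive_remove.
- exact: contra (sub _) unz.
- exact: contra (sub _) nunz.
- apply/consistent_falsify; exists b => //=.
  by rewrite (exclusive_entails_neg exzs wz zz wnz) // (succ_entails wu).
- apply: (@outdeg_gt0 _ _ d); last by rewrite negK uE occurs_partner.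
  rewrite mem_filter dphi andbT /= orbF; apply/negP => zd.
  by case/eqP: wnz; exact: irreducible_disjoint wd zd.
- rewrite -ltnS; apply: leq_trans out2; apply: (outdeg_falsify_lt cphi).
    by rewrite nuE occurs_partner.
  by rewrite /= zc.
move=> phi' exphi'.
by apply: reducible_remove exphi' _; rewrite ?irreducible_outdeg ?size_rem.
Qed.

(* The default [u] is never reached when [z] entails [u]. *)
Definition common_succ z := head u [seq p <- succs phi z | `[< entails phi p u >]].
Definition private_succ z := head u (rem (common_succ z) (succs phi z)).

Lemma mem_common_succ z : z \in entailing u ->
  common_succ z \in succs phi z /\ entails phi (common_succ z) u.
Proof.
case/mem_entailing => zz zu; have [unz _] := source_notin_inputs.
suff : common_succ z \in [seq p <- succs phi z | `[< entails phi p u >]].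
  by rewrite mem_filter => /andP[/asboolP].
have [p psucc pu] := entailing_succ zz unz zu; rewrite /common_succ.
have: p \in [seq p <- succs phi z | `[< entails phi p u >]].
  by rewrite mem_filter psucc andbT; exact/asboolP.
by case: filter => // q s _; exact: mem_head.
Qed.

Lemma perm_succs z : z \in entailing u ->
  perm_eq (succs phi z) [:: common_succ z; private_succ z].
Proof.
move=> zu; have [csucc _] := mem_common_succ zu; have [zz _] := mem_entailing _ _ zu.
rewrite (permPl (perm_to_rem csucc)) /private_succ perm_cons.
have : size (rem (common_succ z) (succs phi z)) = 1.
  by rewrite size_rem // size_succs irreducible_outdeg.
by case: rem => [|q []].
Qed.

Lemma mem_private_succ z : z \in entailing u -> private_succ z \in succs phi z.
Proof. by move/perm_succs/perm_mem->; rewrite !inE eqxx orbT. Qed.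

Lemma common_succ_entailed z z' : z \in entailing u -> z' \in entailing u ->
  entails phi z' (common_succ z).
Proof.
move=> zu; have [csucc cu] := mem_common_succ zu.
exact: source_entailed (entailing_sub zu) csucc cu.
Qed.

(* Each input in [entailing u] makes both common successors true, so by
   [consistent_helly] they are consistent with the two private successors; both
   inputs can then be set true at once. *)
Lemma private_succ_exclusive z z' : z \in entailing u -> z' \in entailing u ->
  consistent phi [:: private_succ z; private_succ z'] -> z = z'.
Proof.
move=> zu z'u cqq; have [_ cz ez] := exzs.
have [[zz _] [zz' _]] := (mem_entailing _ _ zu, mem_entailing _ _ z'u).
have cwith y : y \in entailing u ->
    consistent phi [:: common_succ z; common_succ z'; private_succ y].
  move=> yu; have [yz _] := mem_entailing _ _ yu; have [a aphi /andP[ay _]] := cz _ yz.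
  exists a; rewrite //= (common_succ_entailed zu yu) //.
  by rewrite (common_succ_entailed z'u yu) // (succ_entails (mem_private_succ yu)).
have [a aphi /and5P[apz apz' aqz aqz' _]] := consistent_helly
  (As := [:: common_succ z; common_succ z']) (cwith z zu) (cwith z' z'u) cqq.
have asuccs y : y \in entailing u -> eval_lit a (common_succ y) ->
    eval_lit a (private_succ y) -> all (eval_lit a) (succs phi y).
  by move=> yu ap aq; rewrite (perm_all _ (perm_succs yu)) /= ap aq.
have aphi' := satisfies_set_input zz aphi (asuccs z zu apz aqz).
have nzz' : z != neg z'.
  by apply: contraTneq zz => ->; apply: (exclusive_neg exzs) => //; exact: ltnW.
apply: ez => //; exists (set_true (set_true a z) z').
  apply: satisfies_set_input => //; apply/allP => p psucc.
  apply: eval_set_true_mono; last exact: allP (asuccs z' z'u apz' aqz') _ psucc.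
  by rewrite -neg_eq; apply: contraTneq zz => <-; rewrite (succ_notin_inputs zz' psucc).
by rewrite /= eval_set_true_id eval_set_true_mono // eval_set_true_id.
Qed.

Lemma private_succ_consistent z : 1 < size (entailing u) -> z \in entailing u ->
  consistent (falsify (u :: zs) phi) [:: private_succ z].
Proof.
move=> Z_gt1 zu; have [zz _] := mem_entailing _ _ zu; have [_ cz _] := exzs.
have qsucc := mem_private_succ zu; have [nq _] := succ_notin_inputs zz qsucc.
have [unz nunz] := source_notin_inputs.
have nqu : ~ entails phi (private_succ z) u.
  move=> qu; have [y yu] := @exists_notin _ _ [:: z] (entailing_uniq u) Z_gt1.
  rewrite inE => /eqP; apply; have [yz _] := mem_entailing _ _ yu.
  have [a aphi /andP[ay _]] := cz _ yz.
  apply: private_succ_exclusive => //; exists a => //=.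
  by rewrite (succ_entails (mem_private_succ yu)) // (source_entailed zz qsucc qu yu).
apply/consistent_falsify.
have : consistent phi (map neg zs ++ [:: private_succ z; neg u]).
  apply: consistent_inputs_off (not_entails nqu) => l.
  by rewrite !inE => /orP[]/eqP->.
by apply: consistentS => l; rewrite /= !(mem_cat, inE) orbC -orbA.
Qed.

Lemma exclusive_private_succs : 1 < size (entailing u) ->
  exclusive (falsify (u :: zs) phi) (map private_succ (entailing u)).
Proof.
move=> Z_gt1; have [_ cz _] := exzs.
have excl z z' : z \in entailing u -> z' \in entailing u ->
    consistent phi [:: private_succ z; private_succ z'] -> z = z'.
  exact: private_succ_exclusive.
split.
- rewrite map_inj_in_uniq ?entailing_uniq // => z z' zu z'u qq.
  have [zz _] := mem_entailing _ _ zu; have [a aphi /andP[az _]] := cz _ zz.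
  apply: excl => //; exists a; rewrite //= -qq.
  by rewrite (succ_entails (mem_private_succ zu)).
- by move=> _ /mapP[z zu ->]; exact: private_succ_consistent.
move=> _ _ /mapP[z zu ->] /mapP[z' z'u ->] /consistent_falsify cqq.
rewrite (excl z z') //; apply: consistentS cqq => l.
by rewrite mem_cat orbC => ->.
Qed.

Lemma nclauses_falsify_source_inputs : neg u \notin inputs_succs ->
  nclauses (falsify (u :: zs) phi) + 2 * size zs + outdeg phi u = nclauses phi.
Proof.
move=> nunz; have [us _ _] := exzs.
rewrite -addnA [_ + outdeg _ _]addnC -count_touched_source ?nclauses_falsify // => z zz.
by apply: contra nunz => nusucc; apply/flatten_mapP; exists z.
Qed.

End Source.

Lemma irreducible_size_bound :
  (forall phi' zs', exclusive phi' zs' -> nclauses phi' < nclauses phi ->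
     size_bound (size zs') (nclauses phi')) ->
  size_bound (size zs) (nclauses phi).
Proof.
move=> IH; have [u su] := exists_source.
have out1 := source_outdeg_gt1 su.
have sizeE := size_not_entailing u; have nE := nclauses_falsify_entailing su.
have nle := leq_nclauses_falsify_inputs u; have a0 := entailing_source_gt0 su.
apply: (@size_bound_split _ (size (entailing u)) _
  (nclauses (falsify (u :: entailing u) phi)) (nclauses (falsify (u :: zs) phi))) => //.
- by rewrite a0; lia.
- by rewrite -sizeE addnK; apply: IH (exclusive_not_entailing u) _; lia.
- have [Z_le1|Z_gt1] := leqP (size (entailing u)) 1; first exact/size_bound_small/ltnW.
  rewrite -(size_map (private_succ u)).
  by apply: IH (exclusive_private_succs su Z_gt1) _; lia.
- by lia.
apply/orP; have [nu_succ|nunz] := boolP (neg u \in inputs_succs).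
  by left; have := source_outdeg_gt2 su nu_succ; lia.
by right; have := nclauses_falsify_source_inputs su nunz; lia.
Qed.

End Irreducible.

Lemma exclusive_size_bound phi zs :
  exclusive phi zs -> size_bound (size zs) (nclauses phi).
Proof.
have [k] := ubnP (nclauses phi); elim: k phi zs => // k IHk phi zs phik exzs.
have IH phi' zs' : exclusive phi' zs' -> nclauses phi' < nclauses phi ->
    size_bound (size zs') (nclauses phi').
  by move=> exzs' lt; apply: IHk exzs'; exact: leq_trans lt _.
have [zs_le2|zs_gt2] := leqP (size zs) 2; first exact: size_bound_small.
have [[phi' [zs' [exzs' [[<- lt]|[szs' lt]]]]]|irr] := pselect (reducible phi zs).
- exact: size_bound_mono (ltnW lt) (IH _ _ exzs' lt).
- by apply: size_bound_pred (lt); rewrite -szs'; apply: IH => //; lia.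
have [zs_le3|zs_gt3] := leqP (size zs) 3; last exact: irreducible_size_bound.
have zsE : size zs = 3 by lia.
have le_size : size zs * 2 <= nclauses phi * 2.
  have [us _ _] := exzs; apply: leq_size_outdeg => // z zz.
  by rewrite ltnNge; apply/negP => /(reducible_outdeg_le1 exzs zs_gt2 zz).
have : 3 <= nclauses phi by lia.
by rewrite /size_bound zsE.
Qed.

End TwoCnf.

(** * Encodings of AMO *)

Lemma set_card_le2 (T : finType) (C : {set T}) :
  C != set0 -> #|C| <= 2 -> exists x y, C = [set x; y].
Proof.
rewrite -card_gt0; case: (ltngtP #|C| 1) => [|C1 _ C2|/eqP/cards1P[x ->] _ _].
- by case: #|C|.
- have /cards2P[x [y [_ ->]]] : #|C| == 2 by rewrite eqn_leq C2.
  by exists x, y.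
by exists x, x; rewrite setUid.
Qed.

Lemma exists_in_set2 (T : finType) (x y : T) (P : pred T) :
  [exists z in [set x; y], P z] = P x || P y.
Proof.
apply/exists_inP/orP => [[z]|].
  by rewrite !inE => /orP[]/eqP-> ?; [left | right].
by case=> ?; [exists x | exists y]; rewrite // !inE eqxx ?orbT.
Qed.

Lemma formula_of_cnf (V : finType) (phi : cnf V) a0 : is_2cnf phi -> eval_cnf a0 phi ->
  exists2 F : formula V, nclauses F = #|phi| & forall a, satisfies a F = eval_cnf a phi.
Proof.
move=> /andP[_ /forall_inP two] /forall_inP sat.
have pairs C : C \in enum phi -> exists x y, C = [set x; y].
  rewrite mem_enum => Cphi; have /exists_inP[x xC _] := sat _ Cphi.
  by apply: set_card_le2 (two _ Cphi); apply/set0Pn; exists x.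
have [cs csE] : exists cs, [seq [set c.1; c.2] | c <- cs] = enum phi.
  elim: (enum phi) pairs => [|C Cs IH] pairs; first by exists [::].
  have [|cs <-] := IH; first by move=> D DCs; apply: pairs; rewrite inE DCs orbT.
  by have [x [y ->]] := pairs C (mem_head _ _); exists ((x, y) :: cs).
exists (Formula [::] cs); first by rewrite cardE -csE size_map.
move=> a; have -> : eval_cnf a phi =
    all (fun C : {set literal V} => [exists x in C, eval_lit a x]) (enum phi).
  by apply/forall_inP/allP => h C Cphi; apply: h; move: Cphi; rewrite mem_enum.
by rewrite -csE all_map; apply: eq_all => c; rewrite /= exists_in_set2.
Qed.

Lemma AMOP n (a : {ffun 'I_n -> bool}) :
  reflect (forall i j, a i -> a j -> i = j) (AMO a).
Proof.
by apply: (iffP card_le1_eqP) => amo i j; have := amo j i; rewrite !inE; auto.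
Qed.

Definition inputs n l : seq (literal ('I_n + 'I_l)) :=
  [seq (inl i, true) | i <- enum 'I_n].

Lemma encoding_exclusive n l (phi : cnf ('I_n + 'I_l))
    (F : formula ('I_n + 'I_l)%type) :
  encodes phi (@AMO n) -> (forall a, satisfies a F = eval_cnf a phi) ->
  exclusive F (inputs n l).
Proof.
move=> enc satE; split.
- by rewrite map_inj_uniq ?enum_uniq // => i j [].
- move=> _ /mapP[i _ ->].
  have [b eb] : exists b, eval_cnf (assign [ffun j => j == i] b) phi.
    by apply/enc/AMOP => j k; rewrite !ffunE => /eqP-> /eqP->.
  by exists (assign [ffun j => j == i] b); rewrite ?satE // /= /eval_lit /= ffunE eqxx.
move=> _ _ /mapP[i _ ->] /mapP[j _ ->] [a]; rewrite satE => ephi.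
rewrite /= /eval_lit /= => /and3P[/eqP ai /eqP aj _].
have /enc/AMOP amo : exists b : {ffun 'I_l -> bool},
    eval_cnf (assign [ffun k => a (inl k)] b) phi.
  exists [ffun k => a (inr k)].
  suff -> : assign [ffun k => a (inl k)] [ffun k => a (inr k)] = a by [].
  by apply/funext => -[k|k] /=; rewrite ffunE.
by rewrite (amo i j) // ffunE.
Qed.

Lemma S2P n : AMO_2cnf_size n (S2 n).
Proof. by rewrite /S2; case: ex_minnP => s /asboolP. Qed.

Lemma S2_min n s : AMO_2cnf_size n s -> S2 n <= s.
Proof. by rewrite /S2; case: ex_minnP => t _ tmin /asboolP/tmin. Qed.

Lemma S2_size_bound n : size_bound n (S2 n).
Proof.
have [l [phi [two enc <-]]] := S2P n.
have [b sat] : exists b, eval_cnf (assign [ffun=> false] b) phi.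
  by apply/enc/AMOP => i j; rewrite ffunE.
have [F <- satE] := formula_of_cnf two sat.
have := exclusive_size_bound (encoding_exclusive enc satE).
by rewrite size_map size_enum_ord.
Qed.

Lemma eval_cnfU1 (V : finType) (a : V -> bool) (C : {set literal V}) (phi : cnf V) :
  eval_cnf a (C |: phi) = [exists x in C, eval_lit a x] && eval_cnf a phi.
Proof.
apply/forall_inP/andP => [h|[hC /forall_inP hphi] D].
  split; first by apply: h; exact: setU11.
  by apply/forall_inP => D Dphi; apply: h; exact: setU1r.
by case/setU1P => [->|/hphi].
Qed.

Lemma is_2cnfU1 (V : finType) (C : {set literal V}) (phi : cnf V) :
  is_clause C -> #|C| <= 2 -> is_2cnf phi -> is_2cnf (C |: phi).
Proof.
move=> clC C2 /andP[/forall_inP cl /forall_inP two].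
by apply/andP; split; apply/forall_inP => D /setU1P[->|]; auto.
Qed.

Lemma is_clause_pair (V : finType) (x y : literal V) :
  (x.1 != y.1) || (x.2 == y.2) -> is_clause [set x; y].
Proof.
case: x y => [v b] [w d] /= vw; apply/forallP => z; rewrite !inE !xpair_eqE.
case: (eqVneq v w) vw => [-> /= /eqP->|vw _]; first by case: (z == w); case: d.
by case: (eqVneq z v) => [->|_]; rewrite ?(negbTE vw); case: b; case: d; case: (z == w).
Qed.

Section Rename.
Variables (V W : finType) (f : V -> W).

Definition rename_lit (x : literal V) : literal W := (f x.1, x.2).

Definition rename (phi : cnf V) : cnf W :=
  [set rename_lit @: C | C : {set literal V} in phi].

Lemma card_rename phi : #|rename phi| <= #|phi|.
Proof. exact: leq_imset_card. Qed.

Lemma eval_rename a phi : eval_cnf a (rename phi) = eval_cnf (a \o f) phi.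
Proof.
apply/forall_inP/forall_inP => [h C Cphi|h _ /imsetP[C Cphi ->]].
  have /exists_inP[_ /imsetP[x xC ->] ax] := h _ (imset_f _ Cphi).
  by apply/exists_inP; exists x.
have /exists_inP[x xC ax] := h _ Cphi.
by apply/exists_inP; exists (rename_lit x); first exact: imset_f.
Qed.

Lemma is_2cnf_rename phi : injective f -> is_2cnf phi -> is_2cnf (rename phi).
Proof.
move=> injf /andP[/forall_inP cl /forall_inP two].
apply/andP; split; apply/forall_inP => _ /imsetP[C Cphi ->]; last first.
  exact: leq_trans (leq_imset_card _ _) (two _ Cphi).
apply/forallP => w; apply/negP => /andP[].
case/imsetP => -[v b] vC [-> bE]; case/imsetP => -[v' b'] vC' [/injf vE b'E].
move: vC vC'; rewrite -{}vE -{}bE -{}b'E => vC vC'.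
by have /forallP/(_ v) := cl _ Cphi; rewrite vC vC'.
Qed.

End Rename.

Lemma S2_le_bin2 n : S2 n <= 'C(n, 2).
Proof.
pose clause (A : {set 'I_n}) : {set literal ('I_n + 'I_0)} :=
  [set (inl i, false) | i in A].
pose phi := [set clause A | A : {set 'I_n} & #|A| == 2].
have cardphi : #|phi| <= 'C(n, 2).
  apply: leq_trans (leq_imset_card _ _) _.
  by rewrite -[in 'C(n, 2)](card_ord n) -card_draws cardsE.
apply: leq_trans (S2_min _) cardphi; exists 0, phi; split=> //.
  apply/andP; split; apply/forall_inP => _ /imsetP[A + ->]; rewrite inE => /eqP A2.
    by apply/forallP => v; apply/negP => /andP[/imsetP[]].
  by rewrite -A2; exact: leq_imset_card.
move=> a; split=> [amo|[b /forall_inP sat]].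
  exists [ffun=> true]; apply/forall_inP => _ /imsetP[A + ->]; rewrite inE => /eqP A2.
  have /subsetPn[i iA ai] : ~~ (A \subset [set i | a i]).
    by apply: contraL amo => /subset_leq_card; rewrite A2 /AMO -ltnNge.
  apply/exists_inP; exists (inl i, false); first exact: imset_f.
  by rewrite inE in ai; rewrite /eval_lit /= (negbTE ai).
apply/AMOP => i j ai aj; apply: contraTeq isT => ij.
have /exists_inP[_ /imsetP[k kij ->]] :
    [exists x in clause [set i; j], eval_lit (assign a b) x].
  by apply/sat/imset_f; rewrite inE cards2 ij.
by move: kij; rewrite !inE => /orP[] /eqP->; rewrite /eval_lit /= ?ai ?aj.
Qed.

Section SplitInput.
Variable n : nat.
Implicit Types a : {ffun 'I_n.+2 -> bool}.

(* The disjunction of the first two inputs becomes the first input of the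
   smaller encoding. *)
Definition merge a (s : bool) : {ffun 'I_n.+1 -> bool} :=
  [ffun i => if i == ord0 then s else a (lift ord0 i)].

Let input0 : 'I_n.+2 := ord0.
Let input1 : 'I_n.+2 := lift ord0 ord0.

Lemma AMO_merge a :
  AMO a -> ~~ (a input0 && a input1) && AMO (merge a (a input0 || a input1)).
Proof.
move=> /AMOP amo; apply/andP; split; first by apply/negP => /andP[a0 /(amo _ _ a0)].
have merged i : merge a (a input0 || a input1) i ->
    a (lift ord0 i) \/ i = ord0 /\ a input0.
  by rewrite ffunE; case: eqP => [-> /orP[]|_]; auto.
apply/AMOP => i j /merged[ai|[-> a0]] /merged[aj|[-> a0']] //.
- exact: lift_inj (amo _ _ ai aj).
- by have := amo _ _ ai a0'.
- by have := amo _ _ a0 aj.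
Qed.

Lemma AMO_of_merge a s : (a input0 ==> s) -> (a input1 ==> s) ->
  ~~ (a input0 && a input1) -> AMO (merge a s) -> AMO a.
Proof.
move=> a0s a1s n01 /AMOP amo.
have merged i : a (lift ord0 i) -> merge a s i.
  by rewrite ffunE; case: eqP => // -> a1; exact: implyP a1s a1.
have first_only i : a input0 -> a (lift ord0 i) -> False.
  move=> a0 ai; case/negP: n01; rewrite a0 /=.
  have -> : input1 = lift ord0 i; last by [].
  congr lift; apply: amo (merged _ ai).
  by rewrite ffunE eqxx (implyP a0s).
apply/AMOP => i j.
case: (unliftP ord0 i) => [i'|] ->; case: (unliftP ord0 j) => [j'|] -> //.
- by move=> ai aj; congr lift; apply: amo; exact: merged.
- by move=> ai a0; case: (first_only i').
- by move=> a0 aj; case: (first_only j').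
Qed.

Variable l : nat.

Definition merge_var (v : 'I_n.+1 + 'I_l) : 'I_n.+2 + 'I_l.+1 :=
  match v with
  | inl i => if i == ord0 then inr ord0 else inl (lift ord0 i)
  | inr j => inr (lift ord0 j)
  end.

Lemma merge_var_inj : injective merge_var.
Proof.
move=> [i|j] [i'|j'] /=; last by move=> e; rewrite (lift_inj (inr_inj e)).
- case: (i =P ord0) => [->|_]; case: (i' =P ord0) => [->|_] // e.
  by rewrite (lift_inj (inl_inj e)).
- by case: (i =P ord0) => // _ e; have := inr_inj e.
- by case: (i' =P ord0) => // _ e; have := inr_inj e.
Qed.

Lemma assign_merge_var a (b : {ffun 'I_l.+1 -> bool}) :
  assign a b \o merge_var = assign (merge a (b ord0)) [ffun j => b (lift ord0 j)].
Proof. by apply/funext => -[i|j] /=; rewrite ffunE //; case: eqP. Qed.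

Definition split_input (phi : cnf ('I_n.+1 + 'I_l)) : cnf ('I_n.+2 + 'I_l.+1) :=
  [set (inl input0, false); (inr ord0, true)] |:
  ([set (inl input1, false); (inr ord0, true)] |:
  ([set (inl input0, false); (inl input1, false)] |: rename merge_var phi)).

Lemma card_split_input phi : #|split_input phi| <= #|phi| + 3.
Proof.
rewrite !cardsU1 [_ + 3]addnC -[3]/(1 + (1 + 1)) -!addnA.
by rewrite !leq_add ?leq_b1 // card_rename.
Qed.

Lemma is_2cnf_split_input phi : is_2cnf phi -> is_2cnf (split_input phi).
Proof.
move=> two.
do 3!(apply: is_2cnfU1; [exact: is_clause_pair | by rewrite cards2; case: eqP |]).
exact: is_2cnf_rename merge_var_inj two.
Qed.

Lemma eval_split_input a (b : {ffun 'I_l.+1 -> bool}) phi :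
  eval_cnf (assign a b) (split_input phi) =
  [&& a input0 ==> b ord0, a input1 ==> b ord0, ~~ (a input0 && a input1)
    & eval_cnf (assign (merge a (b ord0)) [ffun j => b (lift ord0 j)]) phi].
Proof.
rewrite !eval_cnfU1 !exists_in_set2 eval_rename assign_merge_var /eval_lit /=.
by rewrite !implybE negb_and !eqbF_neg !eqb_id.
Qed.

Lemma split_input_encodes phi :
  encodes phi (@AMO n.+1) -> encodes (split_input phi) (@AMO n.+2).
Proof.
move=> enc a; split=> [/AMO_merge/andP[n01 /enc[b sat]]|[b]]; last first.
  rewrite eval_split_input => /and4P[a0 a1 n01 sat].
  by apply: AMO_of_merge a0 a1 n01 _; apply/enc; exists [ffun j => b (lift ord0 j)].
pose b' := [ffun j => if unlift ord0 j is Some j' then b j' else a input0 || a input1].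
exists b'; rewrite eval_split_input {1 2}/b' !ffunE unlift_none n01.
have -> : [ffun j => b' (lift ord0 j)] = b by apply/ffunP => j; rewrite !ffunE liftK.
by rewrite sat; case: (a input0); case: (a input1).
Qed.

End SplitInput.

Lemma S2_succ n : 0 < n -> S2 n.+1 <= S2 n + 3.
Proof.
case: n => // n _; have [l [phi [two enc <-]]] := S2P n.+1.
apply: leq_trans (S2_min _) (card_split_input phi); exists l.+1, (split_input phi).
by split=> //; [exact: is_2cnf_split_input | exact: split_input_encodes].
Qed.

Lemma S2_upper n : 2 < n -> S2 n <= 3 * n - 6.
Proof.
elim: n => // n IH; rewrite ltnS leq_eqVlt => /orP[/eqP<-|n2]; first exact: S2_le_bin2.
by apply: leq_trans (S2_succ (ltnW (ltnW n2))) _; have := IH n2; lia.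
Qed.

Lemma sqrt_bound (R : rcfType) n s : 0 < n -> 4 * n <= (s + 3 - 2 * n) ^ 2 ->
  (2 * n%:R + 2 * Num.sqrt n%:R - 3 <= s%:R :> R)%R.
Proof.
move=> n0 sq.
have sE : s + 3 = 2 * n + (s + 3 - 2 * n) by nia.
move: (s + 3 - 2 * n) sE sq => k sE sq.
rewrite lerBlDr -(natrD _ s 3) sE natrD natrM lerD2l.
rewrite -[leRHS]ger0_norm // -sqrtr_sqr -natrX.
have -> : (2 = Num.sqrt 4 :> R)%R.
  by rewrite (_ : 4 = 2 ^+ 2)%R ?sqrtr_sqr ?ger0_norm // -natrX.
by rewrite -sqrtrM // ler_wsqrtr // -natrM ler_nat.
Qed.

Theorem theorem4 (R : realType) (n : nat) (hn : (3 <= n)%N) :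
  ((n <= 10)%N -> S2 n = (3 * n - 6)%N) /\
  ((9 <= n)%N -> (2 * n%:R + 2 * Num.sqrt n%:R - 3 <= (S2 n)%:R :> R)%R).
Proof.
have lower := S2_size_bound n; split=> [n10|n9].
  by apply/eqP; rewrite eqn_leq S2_upper //; move: lower; rewrite /size_bound n10.
exact: sqrt_bound (ltnW (ltnW hn)) (size_bound_quadratic n9 lower).
Qed.
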